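(* Let $\chi^*$ be the Dynamic NEM (D-NEM) pricing policy of an energy community $\mathcal N=\{1,\dots,N\}$, and let $\psi^*$ be the members' optimal consumption policy, which under D-NEM gives $$d^{\psi^*}_{ik}=\max\{\underline d_{ik},\min\{f_{ik}(\pi^*(g_{\mathcal N})),\overline d_{ik}\}\},\qquad z_i^{\psi^*}=\bm 1^\top\bm d_i^{\psi^*}-g_i,\qquad k\in\mathcal K,\ i\in\mathcal N .$$ Then $(\chi^*,\psi^* )$ is an equilibrium (Stackelberg equilibrium) of the bi-level optimization consisting of the members' surplus maximization (lower level) and the operator's welfare maximization (upper level). Also, the community maximum social welfare under centralized operation is achieved by the equilibrium solution, i.e., $$(\bm d_1^{\psi^*},\dots,\bm d_N^{\psi^*},\bm z^{\psi^*})=\underset{(\bm d_1,\dots,\bm d_N),\,\bm z}{\rm argmax}\ \mathbb E\Big[\sum_{i\in\mathcal N}U_i(\bm d_i)-P^{\rm NEM}(z_{\mathcal N})\Big]$$ $$\text{subject to}\quad z_{\mathcal N}=\sum_{i\in\mathcal N}(\bm 1^\top\bm d_i-g_i),\qquad \underline{\bm d}_i\preceq\bm d_i\preceq\overline{\bm d}_i\ \ \forall i\in\mathcal N .$$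
   Context: Members and resources. Member $i\in\mathcal N$ has devices $k\in\mathcal K=\{1,\dots,K\}$ and chooses a consumption bundle $\bm d_i=(d_{i1},\dots,d_{iK})\in\mathcal D_i=\{\bm d_i:\underline{\bm d}_i\preceq\bm d_i\preceq\overline{\bm d}_i\}\subseteq\mathbb R_+^K$ (elementwise bounds). It has stochastic renewable generation $g_i\in\mathbb R_+$; $\bm g=(g_1,\dots,g_N)$ and $g_{\mathcal N}=\sum_i g_i$. Net consumption is $z_i=\bm 1^\top\bm d_i-g_i$, $\bm z=(z_1,\dots,z_N)$, and $z_{\mathcal N}=\sum_i z_i$. Expectations are over the generation. Utilities. $U_i(\bm d_i)=\sum_{k}U_{ik}(d_{ik})$ is concave, non-decreasing, continuously differentiable and additive; $L_{ik}$ is the marginal utility of $U_{ik}$ and $f_{ik}:=L_{ik}^{-1}$ its inverse. Utility tariff. $P^{\rm NEM}(z)=\pi^+\max\{0,z\}-\pi^-\max\{0,-z\}$ with buy and sell rates $\pi^+,\pi^-\in\mathbb R_+$, $\pi^-\le\pi^+$. A standalone customer's surplus is $S_i^{\rm NEM}=U_i(\bm d_i)-P^{\rm NEM}(z_i)$. Community pricing. A pricing policy $\chi$ defines payment functions $\bm P^\chi=(P_1^\chi,\dots,P_N^\chi)$ of net consumption; member $i$'s surplus is $S_i^\chi(\bm d_i,g_i)=U_i(\bm d_i)-P_i^\chi(z_i)$. $\mathcal A$ is the set of payment functions conforming with the cost-causation principle, i.e. satisfying four axioms: (1) uniform payment function: $z_i=z_j$ implies $P_i^\chi=P_j^\chi$;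 (2) the payment function $P^\chi$ is monotonic and $P^\chi(0)=0$; (3) individual rationality: every member's surplus is no less than its benchmark as a standalone customer under the utility's NEM tariff, $S_i^\chi\ge S_i^{\rm NEM}$; (4) profit neutrality: $\sum_i P_i^\chi(z_i)=P^{\rm NEM}(\sum_i z_i)$. D-NEM. $\chi^*:\bm g\mapsto P^{\chi^*}(z)=\pi^*(g_{\mathcal N})\cdot z$, where $\pi^*(g_{\mathcal N})=\pi^+$ if $g_{\mathcal N}<f_{\mathcal N}(\pi^+)$; $\pi^*(g_{\mathcal N})=\pi^z(g_{\mathcal N})$ if $g_{\mathcal N}\in[f_{\mathcal N}(\pi^+),f_{\mathcal N}(\pi^-)]$; $\pi^*(g_{\mathcal N})=\pi^-$ if $g_{\mathcal N}>f_{\mathcal N}(\pi^-)$. Here $f_{\mathcal N}(y)=\sum_{i\in\mathcal N}\sum_{k\in\mathcal K}\max\{\underline d_{ik},\min\{f_{ik}(y),\overline d_{ik}\}\}$, the thresholds satisfy $f_{\mathcal N}(\pi^+)\le f_{\mathcal N}(\pi^-)$, and $\pi^z(g_{\mathcal N})$ is the solution $\mu$ of $f_{\mathcal N}(\mu)=g_{\mathcal N}$. Bi-level optimization. Lower level: members are price-taking surplus maximizers; given $\chi$, the optimal consumption policy maps $g$ (given the payment function $P^\chi$) to $(\bm d^\psi,z^\psi)=\arg\max\{U(\bm d)-P^\chi(z)\}$ subject to $z=\bm 1^\top\bm d-g$, $\bm d\in\mathcal D$ (member index dropped). Upper level: given the members' consumption policy $\psi$, the operator chooses $P^\chi=\arg\max_{P(\cdot)\in\mathcal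 A}\mathbb E[\sum_{i}U_i(\bm d_i^\psi)-P^{\rm NEM}(z_{\mathcal N})]$ subject to $z_{\mathcal N}=\sum_i(\bm 1^\top\bm d_i^\psi-g_i)$; by profit neutrality this objective is the expected community welfare $W^{\chi,\psi}=\sum_i\mathbb E[S_i^\chi(\psi(g_i),g_i)]$. Stackelberg equilibrium. With $\mathscr X$ the set of the operator's pricing policies (payment functions in $\mathcal A$) and $\Psi$ the set of consumption policies, $(\chi^*,\psi^* )$ is a Stackelberg equilibrium if (a) for all $\chi\in\mathscr X$, $S^\chi(\psi^*(g),g)\ge S^\chi(\psi(g),g)$ for all $\psi\in\Psi$; and (b) for all $\chi\in\mathscr X$, $W^{\chi^*,\psi^*}\ge\mathbb E[\sum_i S_i^\chi(\psi^*(g_i),g_i)]$. Here $\psi^*$ denotes the members' optimal response to the announced pricing policy, so the equilibrium is the optimal community pricing when members respond optimally to it. *)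

(* Defs.v *)
From HB Require Import structures.
From mathcomp Require Export all_boot all_order all_algebra.
From mathcomp Require Export all_classical all_reals all_analysis.
Export Order.TTheory GRing.Theory Num.Theory.
Export numFieldNormedType.Exports.

Set Implicit Arguments.
Unset Strict Implicit.
Unset Printing Implicit Defensive.

Local Open Scope classical_set_scope.
Local Open Scope ring_scope.

Record community (R : realType) (N K : nat) := Community {
  util : 'I_N -> 'I_K -> R -> R;
  dmin : 'I_N -> 'I_K -> R;
  dmax : 'I_N -> 'I_K -> R;
  buy_rate : R;
  sell_rate : R }.

(* psi i p gi is the bundle of member i with generation gi facing the payment
   function p, so a policy is a reaction to whatever payment is announced. *)
Definition consumption_policy (R : realType) (N K : nat) : Type :=
  'I_N -> (R -> R) -> R -> 'I_K -> R.

(* chi g i is the payment function announced to member i when the generation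
   profile is g. *)
Definition pricing_policy (R : realType) (N : nat) : Type :=
  ('I_N -> R) -> 'I_N -> R -> R.

Section EnergyCommunity.
Context {R : realType} {N K : nat} (c : community R N K).

Local Notation bundle := ('I_K -> R).
Local Notation profile := ('I_N -> R).
Local Notation payment := (R -> R).
Local Notation consumption_policy := (consumption_policy R N K).
Local Notation pricing_policy := (pricing_policy R N).

Definition device_range (i : 'I_N) (k : 'I_K) : set R :=
  [set x | dmin c i k <= x <= dmax c i k].

Definition feasible_bundle (i : 'I_N) : set bundle :=
  [set x | forall k, device_range i k (x k)].

Definition utility (i : 'I_N) (x : bundle) : R := \sum_(k < K) util c i k (x k).

Definition marginal (i : 'I_N) (k : 'I_K) : R -> R := derive1 (util c i k).

(* Utilities are only constrained on the consumption range; continuous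
   differentiability on a closed interval is expressed with the two-sided
   derivative, since a C^1 function there extends to a C^1 function on the line
   and no other value of the extension is ever used. *)
Definition admissible_utility (i : 'I_N) (k : 'I_K) : Prop :=
  [/\ convex_function (device_range i k) (\- util c i k),
      {in device_range i k &, {homo util c i k : x y / x <= y}},
      {in device_range i k, forall x, derivable (util c i k) x 1} &
      {within device_range i k, continuous (marginal i k)}].

Definition admissible_community : Prop :=
  [/\ forall i k, 0 <= dmin c i k <= dmax c i k,
      0 <= sell_rate c <= buy_rate c &
      forall i k, admissible_utility i k].

(* f i k is the inverse of the (decreasing) marginal utility. A price need not
   be a value of the marginal utility, so f is a total function, antitone on
   all nonnegative prices: a price above (below) all marginal utilities on the
   consumption range is sent below (above) that range. *)
Definition inverse_marginal (f : 'I_N -> 'I_K -> R -> R) : Prop :=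
  forall i k, {in device_range i k, cancel (marginal i k) (f i k)} /\
    (forall p q : R, 0 <= p -> p <= q -> f i k q <= f i k p).

Definition net (x : bundle) (gi : R) : R := \sum_(k < K) x k - gi.

Definition nem (z : R) : R :=
  buy_rate c * Num.max 0 z - sell_rate c * Num.max 0 (- z).

(* Surplus of member i with own generation gi who pays according to p. *)
Definition surplus (i : 'I_N) (p : payment) (x : bundle) (gi : R) : R :=
  utility i x - p (net x gi).

(* Lower level: price-taking surplus maximisation of one member. *)
Definition optimal_bundle (i : 'I_N) (p : payment) (gi : R) (x : bundle) : Prop :=
  feasible_bundle i x /\
  forall y, feasible_bundle i y -> surplus i p y gi <= surplus i p x gi.

Definition consumption_set : set consumption_policy :=
  [set psi | forall i p gi, 0 <= gi -> feasible_bundle i (psi i p gi)].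

(* A monotone payment may jump, and then the maximum need not be attained. *)
Definition optimal_policy (psi : consumption_policy) : Prop :=
  consumption_set psi /\
  forall i p gi, 0 <= gi -> (exists x, optimal_bundle i p gi x) ->
    optimal_bundle i p gi (psi i p gi).

Definition nonneg_profile : set profile := [set g | forall i, 0 <= g i].

Definition response (chi : pricing_policy) (psi : consumption_policy)
    (g : profile) (i : 'I_N) : bundle := psi i (chi g i) (g i).

(* The cost-causation axioms, for payment functions p when generation is g and
   the members consume x. Individual rationality compares with the best
   surplus the member could get alone under the NEM tariff; profit neutrality
   holds at the net consumption of the members. *)
Definition cost_causation (g : profile) (x : 'I_N -> bundle)
    (p : 'I_N -> payment) : Prop :=
  [/\ forall i j (z : profile), z i = z j -> p i (z i) = p j (z j),
      forall i, {homo p i : z z' / z <= z'} /\ p i 0 = 0,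
      forall i y, feasible_bundle i y ->
        surplus i nem y (g i) <= surplus i (p i) (x i) (g i) &
      \sum_(i < N) p i (net (x i) (g i)) = nem (\sum_(i < N) net (x i) (g i))].

Section DNEM.
Context (f : 'I_N -> 'I_K -> R -> R) (pz : R -> R).

Definition clamped (i : 'I_N) (k : 'I_K) (y : R) : R :=
  Num.max (dmin c i k) (Num.min (f i k y) (dmax c i k)).

Definition community_demand (y : R) : R :=
  \sum_(i < N) \sum_(k < K) clamped i k y.

(* Where community_demand is flat the solution is not unique; it is taken
   between the two NEM rates, and is otherwise arbitrary. *)
Definition net_zero_price : Prop :=
  forall G, community_demand (buy_rate c) <= G <= community_demand (sell_rate c) ->
    sell_rate c <= pz G <= buy_rate c /\ community_demand (pz G) = G.

Definition dnem_price (G : R) : R :=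
  if G < community_demand (buy_rate c) then buy_rate c
  else if G <= community_demand (sell_rate c) then pz G
  else sell_rate c.

Definition dnem : pricing_policy :=
  fun g _ z => dnem_price (\sum_(i < N) g i) * z.

End DNEM.

Section Expectations.
Context {disp : measure_display} {T : measurableType disp} (P : probability T R)
  (g : 'I_N -> {RV P >-> R}).

Definition gen (w : T) : profile := fun i => g i w.

Definition realized_surplus (chi : pricing_policy) (psi : consumption_policy)
    (i : 'I_N) (w : T) : R :=
  surplus i (chi (gen w) i) (response chi psi (gen w) i) (gen w i).

Definition welfare (chi : pricing_policy) (psi : consumption_policy) : \bar R :=
  (\sum_(i < N) 'E_P[realized_surplus chi psi i])%E.

(* The operator's pricing policies, given that members respond with psi: the
   members' problems are solvable, the payments conform with the
   cost-causation axioms, and the welfare is well defined. *)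
Definition pricing_set (psi : consumption_policy) : set pricing_policy :=
  [set chi |
    [/\ forall h, nonneg_profile h ->
          forall i, exists x, optimal_bundle i (chi h i) (h i) x,
        forall h, nonneg_profile h ->
          cost_causation h (response chi psi h) (chi h) &
        forall i, P.-integrable setT (EFin \o realized_surplus chi psi i)]].

Definition stackelberg (chis : pricing_policy) (psis : consumption_policy) : Prop :=
  [/\ pricing_set psis chis,
      consumption_set psis,
      forall chi, pricing_set psis chi -> forall psi, consumption_set psi ->
        forall h, nonneg_profile h -> forall i,
          surplus i (chi h i) (response chi psi h i) (h i) <=
          surplus i (chi h i) (response chi psis h i) (h i) &
      forall chi, pricing_set psis chi -> (welfare chi psis <= welfare chis psis)%E].

(* Centralised operation: consumption and net consumption are chosen as
   functions of the generation profile. *)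
Definition central_feasible (x : profile -> 'I_N -> bundle)
    (z : profile -> profile) : Prop :=
  [/\ forall h, nonneg_profile h ->
        \sum_(i < N) z h i = \sum_(i < N) net (x h i) (h i),
      forall h, nonneg_profile h -> forall i, feasible_bundle i (x h i) &
      forall i k, measurable_fun setT (fun w => x (gen w) i k)].

Definition central_welfare (x : profile -> 'I_N -> bundle)
    (z : profile -> profile) : \bar R :=
  ('E_P[(fun w => \sum_(i < N) utility i (x (gen w) i) -
                  nem (\sum_(i < N) z (gen w) i))%R])%E.

(* The maximiser is unique up to null events. Only the sum of z enters the
   centralised problem; its components are those of net consumption. *)
Definition central_argmax (x : profile -> 'I_N -> bundle)
    (z : profile -> profile) : Prop :=
  [/\ central_feasible x z,
      forall x' z', central_feasible x' z' ->
        (central_welfare x' z' <= central_welfare x z)%E &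
      forall x' z', central_feasible x' z' ->
        central_welfare x' z' = central_welfare x z ->
        {ae P, forall w, (forall i k, x' (gen w) i k = x (gen w) i k) /\
          \sum_(i < N) z' (gen w) i = \sum_(i < N) z (gen w) i}].

End Expectations.

End EnergyCommunity.

(* Main.v *)
(* Under a linear tariff with rate p >= 0 the members' problems split over the
   devices, and the clamped inverse marginal utility is the unique maximiser.
   The NEM tariff dominates p z whenever p lies between its two rates, with
   equality at the aggregate net consumption that the D-NEM price induces.  So
   consumption under D-NEM maximises, for every generation profile, the
   centralised objective, and uniquely; by profit neutrality that objective is
   also the total surplus under any conforming pricing policy.  Measurability
   comes from monotonicity in the aggregate generation. *)
Require Import Defs.
From mathcomp Require Import measurable_realfun ring lra.

Set Implicit Arguments.
Unset Strict Implicit.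
Unset Printing Implicit Defensive.

Local Open Scope classical_set_scope.
Local Open Scope ring_scope.

(* The derivative in the direction y - x treats both orders of x and y at once. *)
Lemma concave_le_tangent (R : realType) (u : R -> R) (D : set R) (x y : R) :
  convex_function D (\- u) -> D x -> D y -> derivable u x 1 ->
  u y <= u x + derive1 u x * (y - x).
Proof.
move=> cu Dx Dy du.
rewrite -lerBlDl.
have dux : differentiable u x by exact/derivable1_diffP.
have -> : derive1 u x * (y - x) = 'D_(y - x) u x.
  by rewrite deriveE// deriv1E//= mulrC.
have cvu : derivable u x (y - x) by exact: diff_derivable.
(* For [0 < h <= 1], concavity on the segment keeps the difference quotient above [u y - u x], and
   this passes to the right limit. *)
rewrite /derive (cvg_at_rightE _ _ cvu); apply: limr_ge.
  by apply/cvg_ex; exists ('D_(y - x) u x); apply: cvg_dnbhs_at_right; exact: cvu.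
near=> h.
have h0 : 0 < h by [].
have h1 : h <= 1 by near: h; exact: nbhs_right_le.
have H : - u (h * y + (1 - h) * x) <= h * - u y + (1 - h) * - u x.
  exact: (cu (Itv01 (ltW h0) h1) y x (mem_set Dy) (mem_set Dx)).
rewrite /GRing.scale /= ler_pdivlMl//.
have -> : h * (y - x) + x = h * y + (1 - h) * x by ring.
lra.
Unshelve. all: by end_near. Qed.

(** * One device facing a linear price *)

Section Device.
Context (R : realType) (u : R -> R) (a b : R).
Let D : set R := [set x | a <= x <= b].
Let L := derive1 u.
Context (fd : R -> R).
Context (ab : a <= b).
Context (u_concave : convex_function D (\- u)).
Context (u_mono : {in D &, {homo u : x y / x <= y}}).
Context (u_deriv : {in D, forall x, derivable u x 1}).
Context (L_cont : {within D, continuous L}).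
Context (LK : {in D, cancel L fd}).
Context (fd_anti : forall p q : R, 0 <= p -> p <= q -> fd q <= fd p).

Let tangent x y : D x -> D y -> u y <= u x + L x * (y - x).
Proof.
by move=> Dx Dy; apply: (concave_le_tangent u_concave) => //; apply/u_deriv/mem_set.
Qed.

(** The tangents at both points give weak decrease; the left inverse [fd] makes [L] injective on the
    range, hence strictness. *)
Lemma marginal_decr x y : D x -> D y -> x < y -> L y < L x.
Proof.
move=> Dx Dy xy; rewrite lt_neqAle; apply/andP; split.
  apply/eqP => /(congr1 fd); rewrite !LK ?inE// => yx.
  by rewrite yx ltxx in xy.
have := tangent Dx Dy; have := tangent Dy Dx; nra.
Qed.

(** Chaining the tangents at [x] and at the midpoint gains strictly, because the slope has strictly
    changed in between. *)
Lemma lt_tangent x y : D x -> D y -> y != x -> u y < u x + L x * (y - x).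
Proof.
move=> Dx Dy yx.
pose z := (x + y) / 2.
have Dz : D z by move: Dx Dy; rewrite /D /z /=; lra.
have t1 := tangent Dx Dz; have t2 := tangent Dz Dy.
have -> : L x * (y - x) = L x * (z - x) + L x * (y - z) by ring.
case: (ltgtP x y) yx => // xy _.
  have xz : x < z by rewrite /z; lra.
  have yz : z < y by rewrite /z; lra.
  have := marginal_decr Dx Dz xz; nra.
have xz : z < x by rewrite /z; lra.
have yz : y < z by rewrite /z; lra.
have := marginal_decr Dz Dx xz; nra.
Qed.

Let clamp p := Num.max a (Num.min (fd p) b).

Lemma clamp_range p : D (clamp p).
Proof. by rewrite /D /clamp /= le_max lexx /= ge_max ab ge_min lexx orbT. Qed.

Lemma clamp_anti p q : 0 <= p -> p <= q -> clamp q <= clamp p.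
Proof.
move=> p0 pq; rewrite /clamp ge_max le_max lexx /= le_max; apply/orP; right.
by rewrite le_min !ge_min fd_anti//= lexx orbT.
Qed.

(** First-order optimality as a variational inequality. On a nondegenerate range the clamp sits at
    [a] when [p] is at least [L a], at [b] when [p] is at most [L b], and otherwise where [L] takes
    the value [p], by the intermediate value theorem. *)
Lemma clamp_first_order p y : 0 <= p -> D y ->
  0 <= (p - L (clamp p)) * (y - clamp p).
Proof.
move=> p0 Dy.
have [ab'|ba] := ltP a b; last first.
  have -> : y = clamp p.
    by have := clamp_range p; move: Dy; rewrite /D /=; lra.
  by rewrite subrr mulr0.
have Da : D a by rewrite /D /= lexx ltW.
have Db : D b by rewrite /D /= lexx ltW.
(* Monotone utility makes [L a] nonnegative, so that antitonicity of [fd], assumed only for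
   nonnegative prices, applies from [L a] up to [p]. *)
have La0 : 0 <= L a.
  have := tangent Da Db; have := u_mono (mem_set Da) (mem_set Db) (ltW ab').
  rewrite -/L; nra.
have [pa|pa] := leP (L a) p.
  have -> : clamp p = a.
    rewrite /clamp; apply/max_idPl; rewrite ge_min.
    by have := fd_anti La0 pa; rewrite LK ?inE// => ->.
  by apply: mulr_ge0; move: Dy; rewrite /D /=; lra.
have [pb|pb] := leP p (L b).
  have -> : clamp p = b.
    rewrite /clamp; have := fd_anti p0 pb; rewrite LK ?inE// => bf.
    by rewrite (min_idPr bf) (max_idPr ab).
  by rewrite -mulrNN; apply: mulr_ge0; move: Dy; rewrite /D /=; lra.
have DE : D = `[a, b]%classic by apply/seteqP; split => x /=; rewrite in_itv.
have [||x xab Lx] := @IVT _ L a b p ab.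
- by move: L_cont; rewrite DE.
- rewrite ge_min le_max (ltW pa) (ltW pb) orbT //.
have Dx : D x by rewrite DE.
have -> : clamp p = x.
  rewrite /clamp -Lx LK ?inE//.
  by move: Dx => /andP[ax xb]; rewrite (min_idPl xb) (max_idPr ax).
by rewrite Lx subrr mul0r.
Qed.

(** Strict tangency at the clamp, plus the first-order condition, which absorbs the gap between [p]
    and the slope there. *)
Lemma clamp_lt_max p y : 0 <= p -> D y -> y != clamp p ->
  u y - p * y < u (clamp p) - p * clamp p.
Proof.
move=> p0 Dy yc; have := clamp_first_order p0 Dy.
have := lt_tangent (clamp_range p) Dy yc; nra.
Qed.

End Device.

(** * Aggregate demand, the D-NEM price and the pointwise central optimum *)

Section Community.
Context (R : realType) (N K : nat) (c : community R N K).
Context (f : 'I_N -> 'I_K -> R -> R) (pz : R -> R).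
Context (c_adm : admissible_community c) (f_inv : inverse_marginal c f).

Local Notation cl := (clamped c f).
Local Notation demand := (community_demand c f).
Local Notation price := (dnem_price c f pz).

Lemma clamped_range i k p : device_range c i k (cl i k p).
Proof. by have [/(_ i k)/andP[_ ?] _ _] := c_adm; exact: clamp_range. Qed.

Lemma clamped_anti i k p q : 0 <= p -> p <= q -> cl i k q <= cl i k p.
Proof. by have [_ ?] := f_inv i k; exact: clamp_anti. Qed.

(** The equality case of [leif] records uniqueness of the maximiser, and [leif_sum] carries it to
    bundles and profiles. *)
Lemma clamped_leif i k p y : 0 <= p -> device_range c i k y ->
  util c i k y - p * y <= util c i k (cl i k p) - p * cl i k p
    ?= iff (y == cl i k p).
Proof.
move=> p0 Dy; have [/(_ i k)/andP[_ ab] _ /(_ i k)[u1 u2 u3 u4]] := c_adm.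
have [LK fa] := f_inv i k.
have [->|yc] := eqVneq y (cl i k p); first exact/leif_refl.
have lt := clamp_lt_max ab u1 u2 u3 u4 LK fa p0 Dy yc.
by split; [exact: ltW | rewrite lt_eqF].
Qed.

Lemma bundle_leif i p (x : 'I_K -> R) : 0 <= p -> feasible_bundle c i x ->
  utility c i x - p * \sum_k x k
    <= utility c i (fun k => cl i k p) - p * \sum_k cl i k p
    ?= iff [forall k, x k == cl i k p].
Proof.
move=> p0 Dx; rewrite !mulr_sumr /utility -!sumrB.
by apply: leif_sum => k _; exact: clamped_leif.
Qed.

Lemma profile_leif p (x : 'I_N -> 'I_K -> R) : 0 <= p ->
  (forall i, feasible_bundle c i (x i)) ->
  \sum_i (utility c i (x i) - p * \sum_k x i k)
    <= \sum_i (utility c i (fun k => cl i k p) - p * \sum_k cl i k p)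
    ?= iff [forall i, [forall k, x i k == cl i k p]].
Proof. by move=> p0 Dx; apply: leif_sum => i _; exact: bundle_leif. Qed.

(** Generation only shifts the surplus by the constant [p * gi], so optimality is the equality case
    of [bundle_leif]. *)
Lemma optimal_bundleP i p gi x : 0 <= p ->
  optimal_bundle c i (fun z => p * z) gi x <-> x = fun k => cl i k p.
Proof.
have sE y : surplus c i (fun z => p * z) y gi =
    utility c i y - p * (\sum_k y k) + p * gi.
  by rewrite /surplus /net; ring.
move=> p0; split=> [[Dx xopt]|->].
  have := xopt (fun k => cl i k p) (fun k => clamped_range i k p).
  rewrite !sE lerD2r (ge_leif (bundle_leif p0 Dx)) => /forallP xE.
  by apply/funext => k; exact/eqP.
split=> [k|y Dy]; first exact: clamped_range.
by rewrite !sE lerD2r (bundle_leif p0 Dy).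
Qed.

Lemma demand_anti p q : 0 <= p -> p <= q -> demand q <= demand p.
Proof.
by move=> p0 pq; apply: ler_sum => i _; apply: ler_sum => k _; exact: clamped_anti.
Qed.

Context (pz_sol : net_zero_price c f pz).

Lemma price_range G : sell_rate c <= price G <= buy_rate c.
Proof.
have [_ /andP[s0 sb] _] := c_adm; rewrite /dnem_price.
case: (ltP G) => [_|bG]; first by rewrite sb lexx.
case: (leP G) => [Gs|_]; last by rewrite lexx sb.
by have [|//] := pz_sol (G := G); rewrite bG Gs.
Qed.

Lemma price_ge0 G : 0 <= price G.
Proof.
have [_ /andP[s0 _] _] := c_adm; have /andP[+ _] := price_range G.
exact: le_trans.
Qed.

(* On the net-zero interval the price is a selection of the inverse of the
   antitone demand, hence antitone, and so measurable, for every choice of the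
   selection. *)
Lemma price_anti : {homo price : G H / G <= H >-> H <= G}.
Proof.
move=> G H; rewrite le_eqVlt => /predU1P[->//|GH].
(* These two bounds settle the cases where [G] lies below the net-zero interval or [H] above it. *)
have /andP[_ pb] := price_range H; have /andP[ps _] := price_range G.
move: pb ps; rewrite /dnem_price.
case: (ltP G) => // bG; have bH := le_trans bG (ltW GH).
rewrite [H < _]ltNge bH /=; case: (leP H) => // Hs _ _.
have Gs := le_trans (ltW GH) Hs; rewrite Gs.
have [|/andP[sG _] eG] := pz_sol (G := G); first by rewrite bG Gs.
have [|_ eH] := pz_sol (G := H); first by rewrite bH Hs.
have [_ /andP[s0 _] _] := c_adm.
rewrite leNgt; apply/negP => /ltW/(demand_anti (le_trans s0 sG)).
by rewrite eG eH leNgt GH.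
Qed.

(** [nem] is convex and piecewise linear, with slopes [sell_rate c] and [buy_rate c] on the two
    sides of 0, so [p] is a subgradient at 0. *)
Lemma nem_ge p z : sell_rate c <= p <= buy_rate c -> p * z <= nem c z.
Proof.
rewrite /nem => /andP[sp pb]; have [z0|z0] := leP 0 z.
  by rewrite (max_idPl _) ?oppr_le0// mulr0 subr0 ler_wpM2r.
rewrite (max_idPr _) ?oppr_ge0 ?(ltW z0)// mulr0 sub0r mulrN opprK.
by rewrite ler_wnM2r ?(ltW z0).
Qed.

Let dp (h : 'I_N -> R) i k := cl i k (price (\sum_j h j)).

(** Complementarity: the buy rate goes with an aggregate deficit, the sell rate with an aggregate
    surplus, and in between net consumption is zero. *)
Lemma nem_clearing (h : 'I_N -> R) : 
  nem c (\sum_i net (dp h i) (h i)) =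
  price (\sum_i h i) * \sum_i net (dp h i) (h i).
Proof.
have -> : \sum_i net (dp h i) (h i) =
    demand (price (\sum_i h i)) - \sum_i h i by rewrite sumrB.
move: (\sum_i h i) => G; rewrite /dnem_price /nem.
case: (ltP G) => [Gb|bG].
  have z0 : 0 <= demand (buy_rate c) - G by rewrite subr_ge0 ltW.
  by rewrite (max_idPr z0) (max_idPl _) ?oppr_le0// mulr0 subr0.
case: (leP G) => [Gs|sG].
  have [|_ ->] := pz_sol (G := G); first by rewrite bG Gs.
  by rewrite subrr oppr0 maxxx !mulr0 subrr.
have z0 : demand (sell_rate c) - G <= 0 by rewrite subr_le0 ltW.
by rewrite (max_idPl z0) (max_idPr _) ?oppr_ge0// mulr0 sub0r mulrN opprK.
Qed.

(** Weak duality with the D-NEM price as multiplier: replacing [nem] by the linear tariff can only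
    raise the objective, and leaves it unchanged at [dp h]. Uniqueness is the equality case of
    [profile_leif]. *)
Lemma central_le (h : 'I_N -> R) (x : 'I_N -> 'I_K -> R) :
  (forall i, feasible_bundle c i (x i)) ->
  let w y := \sum_i utility c i (y i) - nem c (\sum_i net (y i) (h i)) in
  w x <= w (dp h) /\ (w (dp h) <= w x -> forall i k, x i k = dp h i k).
Proof.
move=> Dx w; set p := price (\sum_i h i).
have [le eq] := profile_leif (price_ge0 (\sum_i h i)) Dx.
have linE y : \sum_i (utility c i (y i) - p * \sum_k y i k) =
    \sum_i utility c i (y i) - p * (\sum_i net (y i) (h i)) - p * \sum_i h i.
  have -> : \sum_i net (y i) (h i) = \sum_i \sum_k y i k - \sum_i h i.
    by rewrite sumrB.
  rewrite sumrB -mulr_sumr; ring.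
have wx : w x <= \sum_i utility c i (x i) - p * (\sum_i net (x i) (h i)).
  by rewrite lerD2l lerN2; exact/nem_ge/price_range.
have wd : w (dp h) =
    \sum_i utility c i (dp h i) - p * (\sum_i net (dp h i) (h i)).
  by rewrite /w nem_clearing.
move: le eq; rewrite -/p (linE x) (linE (dp h)) => le eq; split; first by lra.
move=> wle; have e : [forall i, [forall k, x i k == cl i k p]].
  by rewrite -eq; apply/eqP; lra.
by move=> i k; apply/eqP; move: e => /forallP/(_ i)/forallP/(_ k).
Qed.

End Community.

Lemma normr_itv (R : realDomainType) (a b x : R) :
  a <= x <= b -> `|x| <= `|a| + `|b|.
Proof.
have := ler_norm b; have := ler_norm (- a); rewrite normrN ler_norml.
have := normr_ge0 a; have := normr_ge0 b; lra.
Qed.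

(** * Integrability and comparison of expectations *)

Section Probability.
Context (R : realType) (disp : measure_display) (T : measurableType disp)
  (P : probability T R).

Lemma integrable_range (X : T -> R) (a b : R) : measurable_fun setT X ->
  (forall w, a <= X w <= b) -> P.-integrable setT (EFin \o X).
Proof.
move=> mX Xab; apply: (@le_integrable _ _ _ P setT measurableT
    (EFin \o X) (EFin \o cst (`|a| + `|b|))).
- exact/measurable_EFinP.
- move=> w _ /=; rewrite lee_fin [leRHS]ger0_norm ?addr_ge0//.
  exact: normr_itv.
- exact: finite_measure_integrable_cst.
Qed.

Lemma integrable_sumR (I : Type) (s : seq I) (X : I -> T -> R) :
  (forall i, P.-integrable setT (EFin \o X i)) ->
  P.-integrable setT (EFin \o (fun w => \sum_(i <- s) X i w)).
Proof.
move=> iX; have -> : EFin \o (fun w => \sum_(i <- s) X i w) =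
    (fun w => \sum_(i <- s) (EFin \o X i) w)%E.
  by apply/funext => w; rewrite /= sumEFin.
exact: integrable_sum.
Qed.

Lemma expectation_le_integrable (X Y : T -> R) :
  P.-integrable setT (EFin \o X) -> P.-integrable setT (EFin \o Y) ->
  (forall w, X w <= Y w) -> ('E_P[X] <= 'E_P[Y])%E.
Proof.
move=> iX iY XY; rewrite unlock; apply: le_integral => // w _.
by rewrite lee_fin.
Qed.

(** The nonnegative difference of [Y] and [X] has zero integral, hence vanishes almost
    everywhere. *)
Lemma expectation_le_eq_ae (X Y : T -> R) :
  P.-integrable setT (EFin \o X) -> P.-integrable setT (EFin \o Y) ->
  (forall w, X w <= Y w) -> ('E_P[X] = 'E_P[Y])%E -> {ae P, forall w, X w = Y w}.
Proof.
move=> iX iY XY; rewrite unlock => eXY.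
have mYX : measurable_fun setT (EFin \o (Y \- X)).
  by apply/measurable_EFinP; apply: measurable_funB;
    apply/measurable_EFinP; apply: measurable_int; eassumption.
have : (\int[P]_(w in setT) `|(EFin \o (Y \- X)%R) w|)%E = 0%E.
  transitivity (\int[P]_w ((Y w)%:E - (X w)%:E))%E.
    by apply: eq_integral => w _; rewrite /= -EFinB ger0_norm// subr_ge0.
  rewrite integralB_EFin// -eXY subee//.
  exact: integrable_fin_num iX.
move=> /ae_eq_integral_abs -/(_ measurableT mYX); apply: filterS => w /(_ I) [] /eqP.
by rewrite subr_eq0 => /eqP.
Qed.

Lemma expectation_sum_integrable (n : nat) (X : 'I_n -> T -> R) :
  (forall i, P.-integrable setT (EFin \o X i)) ->
  (\sum_(i < n) 'E_P[X i] = 'E_P[(fun w => \sum_(i < n) X i w)%R])%E.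
Proof.
move=> iX; rewrite expectation.unlock -(integral_sum measurableT iX).
by apply: eq_integral => w _; rewrite -sumEFin.
Qed.

End Probability.

(** * Integrability of utilities, payments and surpluses *)

Section Market.
Context (R : realType) (N K : nat) (c : community R N K).
Context (disp : measure_display) (T : measurableType disp) (P : probability T R).
Context (g : 'I_N -> {RV P >-> R}) (g_int : forall i, P.-integrable setT (EFin \o g i)).
Context (c_adm : admissible_community c).

Lemma nem_mono : {homo nem c : z z' / z <= z'}.
Proof.
have [_ /andP[s0 sb] _] := c_adm => z z' zz'; rewrite /nem lerB//.
  by rewrite ler_wpM2l ?(le_trans s0)// ge_max le_max lexx /= le_max zz' orbT.
by rewrite ler_wpM2l// ge_max le_max lexx /= le_max lerN2 zz' orbT.
Qed.

Lemma nem_norm z : `|nem c z| <= buy_rate c * `|z|.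
Proof.
have [_ /andP[s0 sb] _] := c_adm; rewrite /nem.
have [z0|z0] := leP 0 z.
  rewrite (max_idPl _) ?oppr_le0// mulr0 subr0 normrM !ger0_norm//.
  exact: le_trans sb.
rewrite (max_idPr _) ?oppr_ge0 ?(ltW z0)// mulr0 sub0r normrN normrM normrN.
by rewrite (ger0_norm s0) ler_wpM2r.
Qed.

(** Monotonicity makes [nem c] Borel, and its linear growth bounds the payment by a multiple of
    [Z]. *)
Lemma integrable_nem (Z : T -> R) : P.-integrable setT (EFin \o Z) ->
  P.-integrable setT (EFin \o (nem c \o Z)).
Proof.
move=> iZ; apply: (le_integrable measurableT _ _ (integrableZl measurableT (buy_rate c) iZ)).
  apply/measurable_EFinP; apply: measurableT_comp; last first.
    by apply/measurable_EFinP; apply: measurable_int; eassumption.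
  by apply: nondecreasing_measurable => //; exact: nem_mono.
move=> w _ /=; rewrite lee_fin normrM (le_trans (nem_norm _))//.
by rewrite ler_wpM2r// ler_norm.
Qed.

(* Composing with the projection onto the range makes the utility globally
   monotone, hence Borel, whatever its values outside the range. *)
Lemma integrable_util i k (X : T -> R) : measurable_fun setT X ->
  (forall w, device_range c i k (X w)) ->
  P.-integrable setT (EFin \o (util c i k \o X)).
Proof.
move=> mX XD; have [/(_ i k)/andP[_ ab] _ /(_ i k)[_ u_mono _ _]] := c_adm.
pose r x := Num.max (dmin c i k) (Num.min x (dmax c i k)).
have rD x : r x \in device_range c i k.
  by rewrite inE /device_range /r /= le_max lexx /= ge_max ab ge_min lexx orbT.
have -> : util c i k \o X = (util c i k \o r) \o X.
  apply/funext => w; rewrite /= /r; have /andP[aX Xb] := XD w.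
  by rewrite (min_idPl Xb) (max_idPr aX).
apply: (@integrable_range _ _ _ _ _ (util c i k (dmin c i k)) (util c i k (dmax c i k))).
  apply: measurableT_comp => //; apply: nondecreasing_measurable => // x y xy /=.
  apply: u_mono => //; rewrite /r ge_max le_max lexx /= le_max.
  by rewrite le_min !ge_min xy lexx !orbT.
move=> w; have := rD (X w); rewrite inE => /andP[ar rb].
by rewrite !u_mono// inE /device_range /= ?lexx ?ab.
Qed.

Context (x : T -> 'I_N -> 'I_K -> R)
  (x_meas : forall i k, measurable_fun setT (fun w => x w i k))
  (x_feas : forall w i, feasible_bundle c i (x w i)).

Lemma integrable_utility i :
  P.-integrable setT (EFin \o (fun w => utility c i (x w i))).
Proof.
by apply: integrable_sumR => k; apply: integrable_util => // w; exact: x_feas.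
Qed.

Lemma integrable_net i :
  P.-integrable setT (EFin \o (fun w => net (x w i) (g i w))).
Proof.
apply: (@integrableB _ _ _ P setT measurableT
  (EFin \o (fun w => \sum_k x w i k)) _ _ (g_int i)).
apply: integrable_sumR => k; apply: integrable_range (x_meas i k) _ => w.
exact: x_feas.
Qed.

Lemma integrable_central : P.-integrable setT (EFin \o (fun w =>
  \sum_i utility c i (x w i) - nem c (\sum_i net (x w i) (g i w)))).
Proof.
apply: (@integrableB _ _ _ P setT measurableT
  (EFin \o (fun w => \sum_i utility c i (x w i)))
  (EFin \o (nem c \o (fun w => \sum_i net (x w i) (g i w))))).
  by apply: integrable_sumR; exact: integrable_utility.
by apply: integrable_nem; apply: integrable_sumR; exact: integrable_net.
Qed.

Lemma integrable_linear_surplus i (p : T -> R) (a b : R) :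
  measurable_fun setT p -> (forall w, a <= p w <= b) ->
  P.-integrable setT (EFin \o (fun w =>
    surplus c i (fun z => p w * z) (x w i) (g i w))).
Proof.
move=> mp pab; apply: (@integrableB _ _ _ P setT measurableT
  (EFin \o (fun w => utility c i (x w i)))
  (EFin \o (fun w => p w * net (x w i) (g i w)))).
  exact: integrable_utility.
apply: (@integrableMr _ _ _ P setT measurableT p
  (EFin \o (fun w => net (x w i) (g i w)))) => //; last first.
  exact: integrable_net.
exists (`|a| + `|b|); split; first exact: num_real.
move=> M abM w _ /=; apply: (le_trans _ (ltW abM)).
exact: normr_itv.
Qed.

End Market.

(** * Equilibrium and central optimality *)

Theorem theorem1 (R : realType) (N K : nat) (c : community R N K)
    (disp : measure_display) (T : measurableType disp) (P : probability T R)
    (g : 'I_N -> {RV P >-> R})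
    (f : 'I_N -> 'I_K -> R -> R) (pz : R -> R)
    (psi : consumption_policy R N K)
    (c_adm : admissible_community c)
    (g_ge0 : forall i w, 0 <= g i w)
    (g_int : forall i, P.-integrable setT (EFin \o g i))
    (f_inv : inverse_marginal c f)
    (pz_sol : net_zero_price c f pz)
    (psi_opt : optimal_policy c psi) :
  let chi : pricing_policy R N := dnem c f pz in
  let d : ('I_N -> R) -> 'I_N -> 'I_K -> R := response chi psi in
  let z : ('I_N -> R) -> 'I_N -> R := fun h i => net (d h i) (h i) in
  [/\ forall h, nonneg_profile h -> forall i k,
        d h i k = Num.max (dmin c i k)
          (Num.min (f i k (dnem_price c f pz (\sum_(j < N) h j))) (dmax c i k)),
      stackelberg c g chi psi &
      central_argmax c g d z].
Proof.
move=> chi d z; pose p (h : 'I_N -> R) := dnem_price c f pz (\sum_j h j).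
have p_range h : sell_rate c <= p h <= buy_rate c by exact: price_range.
have p_ge0 h : 0 <= p h by exact: price_ge0.
have [psi_feas psi_max] := psi_opt.
have chi_solvable h i : optimal_bundle c i (chi h i) (h i)
    (fun k => clamped c f i k (p h)).
  by apply/(optimal_bundleP c_adm f_inv i (h i) _ (p_ge0 h)).
(* [psi] is only known to pick some maximiser; existence and uniqueness under a linear price
   identify it. *)
have dE h : nonneg_profile h -> d h = fun i k => clamped c f i k (p h).
  move=> h0; apply/funext => i.
  apply: (proj1 (optimal_bundleP c_adm f_inv i (h i) (d h i) (p_ge0 h))).
  by apply: psi_max; [exact: h0 | eexists; exact: chi_solvable].
have gen_ge0 w : nonneg_profile (gen g w) by move=> i; exact: g_ge0.
have d_feas w i : feasible_bundle c i (d (gen g w) i).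
  by rewrite dE// => k; exact: clamped_range.
have G_meas : measurable_fun setT (fun w => \sum_i g i w).
  by apply: measurable_sum => i; exact: measurable_funPT.
(* Measurability is read off the closed form, which is nondecreasing in aggregate generation since
   price and clamp are both antitone. *)
have d_meas i k : measurable_fun setT (fun w => d (gen g w) i k).
  under eq_fun do rewrite dE//.
  apply: (@measurableT_comp _ _ _ _ _ _
    (fun G => clamped c f i k (dnem_price c f pz G))) => //.
  apply: nondecreasing_measurable => // G H GH.
  by apply: (clamped_anti f_inv); [exact: price_ge0 | exact: price_anti].
have p_meas : measurable_fun setT (fun w => p (gen g w)).
  apply: (@measurableT_comp _ _ _ _ _ _ (dnem_price c f pz)) => //.
  by apply: nonincreasing_measurable => // G H; exact: price_anti.
have dnem_adm : pricing_set c g psi chi.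
  split=> [h h0 i|h h0|i].
  - by eexists; exact: chi_solvable.
  - rewrite /cost_causation -/d dE//; split=> [i j y ->//|i|i y Dy|].
    + by rewrite /chi /dnem mulr0; split=> // y y'; exact/ler_wpM2l/p_ge0.
    (* Individual rationality: the surplus of [y] under [nem] is at most its surplus at the D-NEM
       price, itself at most the optimum. *)
    + apply: le_trans (proj2 (chi_solvable h i) _ Dy).
      by rewrite lerD2l lerN2; exact: (nem_ge _ (p_range h)).
    + by rewrite -mulr_sumr nem_clearing.
  - exact: (integrable_linear_surplus g_int c_adm d_meas d_feas i p_meas
      (fun w => p_range (gen g w))).
have central h x : nonneg_profile h -> (forall i, feasible_bundle c i (x i)) ->
    let w y := \sum_i utility c i (y i) - nem c (\sum_i net (y i) (h i)) in
    w x <= w (d h) /\ (w (d h) <= w x -> forall i k, x i k = d h i k).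
  by move=> h0; rewrite dE//; exact: central_le.
(* Profit neutrality turns total payments into [nem] of the aggregate, so every conforming policy is
   judged by the central objective. *)
have surplusE chi' : pricing_set c g psi chi' ->
    (fun w => \sum_i realized_surplus c g chi' psi i w) =
    (fun w => \sum_i utility c i (response chi' psi (gen g w) i) -
       nem c (\sum_i net (response chi' psi (gen g w) i) (g i w))).
  move=> [_ cc _]; apply/funext => w; rewrite sumrB.
  by have [_ _ _ ->] := cc _ (gen_ge0 w).
have resp_feas chi' w i : feasible_bundle c i (response chi' psi (gen g w) i).
  exact/psi_feas/gen_ge0.
split=> [h h0 i k||].
- by rewrite dE.
- split=> // [chi' [solv _ _] psi' feas' h h0 i|chi' adm'].
    have [_] := psi_max i (chi' h i) (h i) (h0 i) (solv h h0 i).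
    by apply; exact: feas'.
  have [[_ _ si] [_ _ si']] := (dnem_adm, adm').
  rewrite /welfare !expectation_sum_integrable//.
  apply: expectation_le_integrable => [||w]; [exact: integrable_sumR..|].
  rewrite (congr1 (@^~ w) (surplusE _ adm')) (congr1 (@^~ w) (surplusE _ dnem_adm)).
  exact: (central _ _ (gen_ge0 w) (resp_feas chi' w)).1.
(* The balance constraint eliminates [z], leaving an objective in consumption alone. *)
- pose W x w := \sum_i utility c i (x (gen g w) i) -
    nem c (\sum_i net (x (gen g w) i) (g i w)).
  have cwE x y : central_feasible c g x y ->
      central_welfare c g x y = ('E_P[W x])%E.
    move=> [eq _ _]; rewrite /central_welfare; congr expectation.
    by apply/funext => w; rewrite eq.
  have W_int x y : central_feasible c g x y ->
      P.-integrable setT (EFin \o W x).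
    move=> [_ feas meas]; apply: (integrable_central g_int c_adm meas) => w i.
    exact: feas.
  have W_le x y : central_feasible c g x y -> forall w, W x w <= W d w.
    by move=> [_ feas _] w; apply: (central _ _ (gen_ge0 w) _).1 => i; exact: feas.
  have d_cf : central_feasible c g d z.
    by split=> // h h0 i; rewrite dE// => k; exact: clamped_range.
  split=> // x y xy.
    by rewrite !cwE//; apply: expectation_le_integrable (W_le _ _ xy);
      apply: W_int; eassumption.
  rewrite !cwE// => eW.
  (* Equal expectations of pointwise ordered integrands force almost sure equality, and pointwise
     uniqueness applies at each such outcome. *)
  have := expectation_le_eq_ae (W_int _ _ xy) (W_int _ _ d_cf) (W_le _ _ xy) eW.
  apply: filterS => w Weq; have [eq feas _] := xy.
  have [_ uniq] := central _ _ (gen_ge0 w) (feas _ (gen_ge0 w)).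
  have xd i k : x (gen g w) i k = d (gen g w) i k.
    by apply: uniq; rewrite -/(W x w) -/(W d w) Weq.
  split=> //; rewrite eq//; apply: eq_bigr => i _; congr net.
  by apply/funext => k.
Qed.
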